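(* For scheduling without payments any number $m$ of tasks on any number $n$ of machines, the Greedy algorithm has Price of Stability $1$ (with respect to mixed Nash equilibria): for every true instance, there is a mixed Nash equilibrium of Greedy whose expected makespan equals the optimal makespan.
   Context: Model: $n$ machines, $m$ indivisible tasks; machine $i$ has private true times $t_{i,j}\ge0$ and declares $\hat t_{i,j}\ge0$. Machines are bound by their declarations: machine $i$ executes an assigned task $j$ for time $\max\{\hat t_{i,j},t_{i,j}\}$. The Greedy algorithm assigns each task $j$ independently to a machine with minimum declared cost $\hat t_{i,j}$ (ties broken arbitrarily). In a mixed strategy profile each machine independently draws her declaration matrix row from a probability distribution; a machine's cost is her expected total execution time $\mathbb E[\sum_j A_{i,j}\max\{\hat t_{i,j},t_{i,j}\}]$, where $A_{i,j}$ indicates that task $j$ is assigned to $i$. A mixed Nash equilibrium is a profile in which no machine can strictly decrease her expected cost by unilaterally changing her strategy. The makespan of a profile is $\mathbb E[\max_i\sum_jA_{i,j}\max\{\hat t_{i,j},t_{i,j}\}]$, and the optimal makespan is $\min_A\max_i\sum_jA_{i,j}t_{i,j}$ over integral allocations. The Price of Stability is the supremum over instances of the ratio between the makespan of the best mixed Nash equilibrium and the optimal makespan. *)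

(* Defs.v *)
From HB Require Import structures.
From mathcomp Require Import all_boot all_order all_algebra.
From mathcomp Require Import all_classical all_reals all_analysis.

Set Implicit Arguments.
Unset Strict Implicit.
Unset Printing Implicit Defensive.

Import Order.TTheory GRing.Theory Num.Theory.
Local Open Scope ring_scope.
Local Open Scope classical_set_scope.

Section Scheduling.
Variables (R : realType) (n m : nat).

(* A declaration row of a machine: one declared time per task. *)
Definition Row := m.-tuple R.

Definition nonneg_row : set Row := [set x | forall j : 'I_m, 0 <= tnth x j].

Definition valid_strategy (P : probability Row R) : Prop :=
  P nonneg_row = 1%E.

(* A tie-breaking rule for Greedy: for each task j, given the column of
   declared costs (one per machine), it returns a machine with minimum
   declared cost.  We require it to be measurable (so that expectations are
   meaningful). *)
Definition tie_breaking (tb : 'I_m -> n.-tuple R -> 'I_n) : Prop :=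
  (forall (j : 'I_m) (c : n.-tuple R) (k : 'I_n), tnth c (tb j c) <= tnth c k)
  /\ (forall (j : 'I_m) (i : 'I_n), measurable [set c | tb j c = i]).

Definition column (d : 'I_n -> Row) (j : 'I_m) : n.-tuple R :=
  [tuple tnth (d i) j | i < n].

Definition greedy_alloc (tb : 'I_m -> n.-tuple R -> 'I_n)
  (d : 'I_n -> Row) (i : 'I_n) (j : 'I_m) : bool :=
  tb j (column d j) == i.

Definition exec_time (t : 'I_n -> 'I_m -> R) (d : 'I_n -> Row)
  (i : 'I_n) (j : 'I_m) : R := Num.max (tnth (d i) j) (t i j).

Definition load tb t (d : 'I_n -> Row) (i : 'I_n) : R :=
  \sum_(j < m | greedy_alloc tb d i j) exec_time t d i j.

Definition realized_makespan tb t (d : 'I_n -> Row) : R :=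
  \big[Num.max/0]_(i < n) load tb t d i.

(* Expectation w.r.t. the product of the independent mixed strategies
   (as iterated integrals, one machine at a time). *)
Fixpoint iexp (P : 'I_n -> probability Row R) (k : nat)
  (f : ('I_n -> Row) -> \bar R) (d : 'I_n -> Row) : \bar R :=
  match k with
  | 0 => f d
  | k'.+1 =>
      match (insub k' : option 'I_n) with
      | Some i => (\int[P i]_x iexp P k' f (fun l => if l == i then x else d l))%E
      | None => iexp P k' f d
      end
  end.

Definition default_row : Row := [tuple (0 : R) | _ < m].

Definition expect (P : 'I_n -> probability Row R)
  (f : ('I_n -> Row) -> \bar R) : \bar R :=
  iexp P n f (fun _ => default_row).

Definition deviate (P : 'I_n -> probability Row R) (i : 'I_n)
  (Q : probability Row R) : 'I_n -> probability Row R :=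
  fun l => if l == i then Q else P l.

Definition exp_cost tb t (P : 'I_n -> probability Row R) (i : 'I_n) : \bar R :=
  expect P (fun d => (load tb t d i)%:E).

Definition exp_makespan tb t (P : 'I_n -> probability Row R) : \bar R :=
  expect P (fun d => (realized_makespan tb t d)%:E).

Definition mixed_NE tb t (P : 'I_n -> probability Row R) : Prop :=
  (forall i, valid_strategy (P i)) /\
  forall (i : 'I_n) (Q : probability Row R), valid_strategy Q ->
    (exp_cost tb t P i <= exp_cost tb t (deviate P i Q) i)%E.

Definition alloc_makespan (t : 'I_n -> 'I_m -> R) (A : {ffun 'I_m -> 'I_n}) : R :=
  \big[Num.max/0]_(i < n) \sum_(j < m | A j == i) t i j.

Definition opt_makespan (t : 'I_n -> 'I_m -> R) : \bar R :=
  (\big[Order.min/+oo]_(A : {ffun 'I_m -> 'I_n}) (alloc_makespan t A)%:E)%E.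

End Scheduling.

(* Main.v *)
(** Fix an optimal allocation [A].  For each task [j] the machine [A j] declares
    its true time, and every other machine declares a random time above
    [c = t (A j) j + 1] whose survival function is [(c / x) ^ (1 / n)].  The
    owners then win all their tasks almost surely, so the makespan is optimal
    and the losers have no cost to save.  An owner that declares [x > c] instead
    still wins with probability at least [c / x], the power [n] of that survival
    function, and pays [x] when it does, so its expected cost on the task is at
    least [c].  Since the work is additive over the tasks, an arbitrary randomized
    deviation is handled by averaging these bounds. *)
Require Import Defs.
From HB Require Import structures.
From mathcomp Require Import all_boot all_order all_algebra.
From mathcomp Require Import all_classical all_reals all_analysis.
From mathcomp Require Import measurable_realfun.
Set Implicit Arguments.
Unset Strict Implicit.
Unset Printing Implicit Defensive.

Import Order.TTheory GRing.Theory Num.Theory.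
Local Open Scope ring_scope.
Local Open Scope classical_set_scope.

(** * Integrals of possibly non-measurable functions *)

Section Integral.
Context d (T : measurableType d) (R : realType).

(* Unlike [ge0_le_integral], no measurability is needed: the inner iterated
   integrals of [iexp] are not known to be measurable in the outer variables. *)
Lemma ge0_le_integral_nomeas (mu : {measure set T -> \bar R})
    (f g : T -> \bar R) :
  (forall x, 0 <= f x)%E -> (forall x, f x <= g x)%E ->
  (\int[mu]_x f x <= \int[mu]_x g x)%E.
Proof.
move=> f0 fg; rewrite !ge0_integralTE //; last first.
  by move=> x; exact: le_trans (f0 x) (fg x).
apply: le_ereal_sup => _ [h hf <-].
by exists h => // x; exact: le_trans (hf x) (fg x).
Qed.

(** [f] is squeezed between [c] times the indicator of [D] and the function equal to [c] on [D] and
    [+oo] off it. Both are measurable with integral [c]. *)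
Lemma ge0_integral_as_cst (P : probability T R) (D : set T) (c : R)
    (f : T -> \bar R) :
  measurable D -> P D = 1%E -> 0 <= c -> (forall x, 0 <= f x)%E ->
  (forall x, D x -> f x = c%:E) -> (\int[P]_x f x = c%:E)%E.
Proof.
move=> mD PD c0 f0 fD.
have PC : P (~` D) = 0%E by rewrite probability_setC // PD subee.
apply/eqP; rewrite eq_le; apply/andP; split.
  pose g x : \bar R := if x \in D then c%:E else +oo%E.
  have -> : (c%:E = \int[P]_x g x)%E.
    have mg : measurable_fun [set: T] g.
      apply: measurable_fun_if => //; try exact: measurable_cst.
      apply: (measurable_fun_bool true).
      rewrite setTI (_ : _ @^-1` _ = D)//.
      by apply/seteqP; split => x /=; [move/set_mem | move/mem_set].
    rewrite (ae_eq_integral (cst c%:E)) //.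
    - by rewrite integral_cst //= probability_setT mule1.
    - exists (~` D); split; [exact: measurableC|exact: PC|].
      move=> x /= h; apply: contra_not h => Dx _.
      by rewrite /g ifT // inE.
  apply: ge0_le_integral_nomeas => // x; rewrite /g.
  by case: ifPn => [|_]; rewrite ?leey // inE => /fD ->.
have -> : (c%:E = \int[P]_x (c%:E * (\1_D x)%:E))%E.
  rewrite ge0_integralZl_EFin //; last first.
    by apply/measurable_EFinP; exact: measurable_indic.
  by rewrite integral_indic // setIT [X in (_ * X)%E]PD mule1.
apply: ge0_le_integral_nomeas => x.
  by apply: mule_ge0; rewrite lee_fin.
rewrite indicE; case: (boolP (x \in D)) => [|_]; last by rewrite mule0.
by rewrite inE => /fD ->; rewrite mule1.
Qed.

End Integral.

(** The logarithm of a Pareto variable is exponential, so this law drives the heavy-tailed bids. *)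
Lemma exponential_tail (R : realType) (r : R) : 0 < r ->
  exists P : probability (measurableTypeR R) R,
    forall s, 0 <= s -> P `]s, +oo[ = (expR (- (r * s)))%:E.
Proof.
move=> r0.
pose P : probability (measurableTypeR R) R :=
  @exponential_distribution_exponential_prob__canonical__probability_measure_Probability R r r0.
exists P => s s0.
have Pneg : P `]-oo, 0[ = 0%E.
  apply: integral0_eq => x /=; rewrite in_itv /= => x0.
  by rewrite lt0_exponential_pdf.
have P0s : P `[0, s] = (1 - expR (- (r * s)))%:E.
  move: s0; rewrite le_eqVlt => /predU1P[<-|s0].
    by rewrite mulr0 oppr0 expR0 subrr set_itv1; exact: integral_set1.
  by rewrite -mulNr EFinB; exact: exponential_prob_itv0c.
have -> : `]s, +oo[ = ~` (`]-oo, 0[ `|` `[0, s]) :> set R.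
  apply/seteqP; split => x /=; rewrite !in_itv /= andbT.
    move=> sx [x0|/andP[_]]; last by rewrite leNgt sx.
    by move: (lt_trans sx x0); rewrite ltNge s0.
  by move/not_orP=> [/negP + /negP]; rewrite -leNgt => -> /=; rewrite -ltNge.
rewrite probability_setC; last exact: measurableU.
rewrite measureU //; last first.
  apply/seteqP; split => x //=; rewrite !in_itv /= => -[] h /andP[].
  by rewrite leNgt h.
rewrite [X in (1 - (X + _))%E]Pneg [X in (1 - (_ + X))%E]P0s add0e.
by rewrite -EFinB opprB addrC subrK.
Qed.

(** * Heavy-tailed declaration rows *)

Section HeavyTail.
Context (R : realType) (n m : nat).

Lemma measurable_all_coord (C : 'I_m -> set R) :
  (forall j, measurable (C j)) ->
  measurable [set y : Row R m | forall j, C j (tnth y j)].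
Proof.
move=> mC.
rewrite (_ : mkset _ = \bigcap_(j in [set: 'I_m]) ((@tnth m R)^~ j @^-1` C j)).
  apply: fin_bigcap_measurable => // j _; rewrite -[X in measurable X]setTI.
  exact: measurable_tnth.
by apply/seteqP; split => y /= h j => [_|]; exact: h.
Qed.

Lemma measurable_coord_gt (j : 'I_m) (x : R) :
  measurable [set y : Row R m | x < tnth y j].
Proof.
rewrite (_ : mkset _ = (@tnth m R)^~ j @^-1` `]x, +oo[).
  by rewrite -[X in measurable X]setTI; exact: measurable_tnth.
by apply/seteqP; split => y /=; rewrite in_itv /= andbT.
Qed.

(* The survival function of a Pareto law of exponent [1/n] and minimum [c]. *)
Definition pareto_tail (c x : R) : R :=
  expR (- (n%:R^-1 * ln (Num.max x c / c))).

Lemma pareto_tail_ge0 c x : 0 <= pareto_tail c x.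
Proof. exact: expR_ge0. Qed.

Lemma pareto_tail_le1 c x : 0 < c -> pareto_tail c x <= 1.
Proof.
move=> c0; rewrite -expR0 ler_expR oppr_le0 mulr_ge0 ?invr_ge0 ?ler0n //.
by rewrite ln_ge0 // ler_pdivlMr // mul1r le_max lexx orbT.
Qed.

Lemma measurable_pareto_tail c : measurable_fun [set: R] (pareto_tail c).
Proof.
apply: measurableT_comp; first exact: measurable_expR.
apply: measurableT_comp => //.
apply: measurable_funM => //.
apply: measurableT_comp; first exact: measurable_ln.
by apply: measurable_funM => //; exact: measurable_maxr.
Qed.

Lemma pareto_tail_exprn c x : (0 < n)%N -> 0 < c ->
  pareto_tail c x ^+ n = c / Num.max x c.
Proof.
move=> n0 c0; have mx0 : 0 < Num.max x c by rewrite lt_max c0 orbT.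
rewrite -expRM_natl mulrN mulrA divff ?pnatr_eq0 -?lt0n // mul1r expRN lnK.
  by rewrite invf_div.
by rewrite posrE divr_gt0.
Qed.

(** A single exponential variable drives all coordinates: only the marginal tails are claimed, so
    the bids on different tasks may be dependent. *)
Lemma heavy_tailed_row (own : pred 'I_m) (a c : 'I_m -> R) :
  (0 < n)%N -> (forall j, 0 < c j) ->
  exists P : probability (Row R m) R,
    (forall S : set (Row R m),
       (forall y, (forall j, if own j then tnth y j = a j
                             else c j <= tnth y j) -> S y) ->
       P S = 1%E) /\
    (forall j x, ~~ own j ->
       ((pareto_tail (c j) x)%:E <= P [set y | (x < tnth y j)%R])%E).
Proof.
move=> n0 c0.
have [|E tailE] := @exponential_tail R n%:R^-1; first by rewrite invr_gt0 ltr0n.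
(* The absolute value puts every bid above [c j] for all [u], not just almost all, so the preimage
   of [S] is the whole space. *)
pose row (u : measurableTypeR R) : Row R m :=
  [tuple if own j then a j else c j * expR `|u : R| | j < m].
have mrow : measurable_fun [set: measurableTypeR R] row.
  apply/measurable_fun_tnthP => j.
  rewrite (_ : _ \o _ = fun u => if own j then a j else c j * expR `|u|).
    case: (own j) => //.
    apply: measurable_funM => //.
    apply: measurableT_comp; first exact: measurable_expR.
    exact: normr_measurable.
  by apply/funext => u /=; rewrite tnth_mktuple.
exists (distribution E (mfun_Sub (mem_set mrow))); split.
  move=> S hS; rewrite -[LHS]/(E (row @^-1` S)).
  rewrite (_ : row @^-1` S = setT) ?probability_setT //.
  apply/seteqP; split => // u _; apply: hS => j.
  rewrite tnth_mktuple; case: (own j) => //.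
  by rewrite ler_peMr ?(ltW (c0 j)) // -expR0 ler_expR.
(* [s] is the value of [u] at which the bid [c j * expR u] reaches [Num.max x (c j)]. *)
move=> j x ownj; set s := ln (Num.max x (c j) / c j).
have mx1 : 1 <= Num.max x (c j) / c j.
  by rewrite ler_pdivlMr // mul1r le_max lexx orbT.
have s0 : 0 <= s by rewrite ln_ge0.
rewrite /pareto_tail -/s -tailE //.
rewrite -[leRHS]/(E (row @^-1` [set y | x < tnth y j])).
apply: le_measure; rewrite ?inE //.
  by rewrite -[X in measurable X]setTI; apply: mrow => //; exact: measurable_coord_gt.
move=> u /=; rewrite in_itv /= andbT => su.
rewrite /row tnth_mktuple (negbTE ownj).
apply: (@le_lt_trans _ _ (Num.max x (c j))); first by rewrite le_max lexx.
rewrite -ltr_pdivrMl // mulrC -[ltLHS]lnK ?posrE ?(lt_le_trans ltr01) //.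
by rewrite ltr_expR (lt_le_trans su) // ler_norm.
Qed.

End HeavyTail.

(** * Evaluating and bounding iterated expectations *)

Section IteratedExpectation.
Context (R : realType) (n m : nat).
Implicit Types (P : 'I_n -> probability (Row R m) R) (d : 'I_n -> Row R m).
Implicit Types (f : ('I_n -> Row R m) -> \bar R).

Definition update d (i : 'I_n) (x : Row R m) : 'I_n -> Row R m :=
  fun l => if l == i then x else d l.

Lemma iexpS P (k : 'I_n) f d :
  iexp P k.+1 f d = (\int[P k]_x iexp P k f (update d k x))%E.
Proof. by rewrite /= valK. Qed.

Lemma iexp_ge0 P k f d :
  (forall d', 0 <= f d')%E -> (k <= n)%N -> (0 <= iexp P k f d)%E.
Proof.
move=> f0; elim: k d => [|k IH] d kn; first exact: f0.
rewrite (iexpS P (Ordinal kn)); apply: integral_ge0 => x _.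
by apply: IH; exact: ltnW.
Qed.

Lemma expect_as_cst P (D : 'I_n -> set (Row R m)) f (c : R) :
  (forall i, measurable (D i)) -> (forall i, P i (D i) = 1%E) -> 0 <= c ->
  (forall d, 0 <= f d)%E -> (forall d, (forall i, D i (d i)) -> f d = c%:E) ->
  expect P f = c%:E.
Proof.
move=> mD PD c0 f0 fD; rewrite /expect.
(* The outer integrals have already fixed the rows of index at least [k]; only those carry
   information in [d]. *)
suff H k d : (k <= n)%N -> (forall i : 'I_n, (k <= i)%N -> D i (d i)) ->
    iexp P k f d = c%:E.
  by apply: H => // i; rewrite leqNgt ltn_ord.
elim: k d => [|k IH] d kn dD; first by apply: fD => i; exact: dD.
rewrite (iexpS P (Ordinal kn)).
apply: (ge0_integral_as_cst (D := D (Ordinal kn))) => //.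
  by move=> x; apply: iexp_ge0 => //; exact: ltnW.
move=> x Dx; apply: IH; first exact: ltnW.
move=> i ki; rewrite /update; case: (eqVneq i (Ordinal kn)) => [->//|ik].
by apply: dD; rewrite ltn_neqAle ki andbT eq_sym.
Qed.

Section Undercut.
Variables (i : 'I_n) (w p : 'I_m -> Row R m -> R).
Hypotheses (w0 : forall j x, 0 <= w j x) (p0 : forall j x, 0 <= p j x).
Hypotheses (mw : forall j, measurable_fun [set: Row R m] (w j))
  (mp : forall j, measurable_fun [set: Row R m] (p j)).

(* The probability that [x] underbids machine [l] on task [j], once the machines
   below [k] have been integrated out. *)
Definition undercut k (x : Row R m) d (j : 'I_m) (l : 'I_n) : R :=
  if (l < k)%N then p j x else (tnth x j < tnth (d l) j)%R%:R.

(** A lower bound on the cost of machine [i] declaring [x]: [w j x] is the price of winning task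
    [j]. Only strict underbidding counts, since it wins under every tie-breaking rule. *)
Definition undercut_cost k (x : Row R m) d : R :=
  \sum_(j < m) w j x * \prod_(l < n | l != i) undercut k x d j l.

Lemma undercut_ge0 k x d j l : 0 <= undercut k x d j l.
Proof. by rewrite /undercut; case: ifP. Qed.

Lemma undercut_cost_ge0 k x d : 0 <= undercut_cost k x d.
Proof.
apply: sumr_ge0 => j _; apply: mulr_ge0 => //.
by apply: prodr_ge0 => l _; exact: undercut_ge0.
Qed.

Lemma measurable_undercut_cost k d (a : 'I_n) :
  measurable_fun [set: Row R m * Row R m]
    (fun z => undercut_cost k z.1 (update d a z.2)).
Proof.
apply: measurable_sum => j; apply: measurable_funM.
  by apply: measurableT_comp; [exact: mw|exact: measurable_fst].
under eq_fun do rewrite big_mkcond.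
apply: measurable_prod => l _; case: (l != i) => //.
rewrite /undercut; case: (l < k)%N.
  by apply: measurableT_comp; [exact: mp|exact: measurable_fst].
have m1 : measurable_fun [set: Row R m * Row R m] (fun z => tnth z.1 j).
  exact: (measurableT_comp (@measurable_tnth _ R m j) measurable_fst).
have m2 : measurable_fun [set: Row R m * Row R m]
    (fun z => tnth (update d a z.2 l) j).
  rewrite /update; case: (l == a) => //.
  exact: (measurableT_comp (@measurable_tnth _ R m j) measurable_snd).
have mb : measurable_fun [set: bool] (fun b : bool => b%:R : R) by [].
exact: (measurableT_comp mb (measurable_fun_ltr m1 m2)).
Qed.

Variable P : 'I_n -> probability (Row R m) R.
Hypothesis tailP : forall l j x, l != i ->
  ((p j x)%:E <= P l [set y | (tnth x j < tnth y j)%R])%E.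

(** In each summand only the factor of machine [k] depends on [y], through an indicator. Linearity
    replaces it by a probability, which [tailP] bounds below by [p j x]. *)
Lemma undercut_cost_step (k : 'I_n) x d : k != i ->
  ((undercut_cost k.+1 x d)%:E <=
   \int[P k]_y (undercut_cost k x (update d k y))%:E)%E.
Proof.
move=> ki.
pose rest j := \prod_(l < n | (l != i) && (l != k)) undercut k x d j l.
have rest0 j : 0 <= rest j by apply: prodr_ge0 => l _; exact: undercut_ge0.
pose B j : set (Row R m) := [set y | tnth x j < tnth y j].
have mB j : measurable (B j) by exact: measurable_coord_gt.
have -> : (\int[P k]_y (undercut_cost k x (update d k y))%:E =
    \int[P k]_y (\sum_(j < m) (w j x * rest j)%:E * (\1_(B j) y)%:E))%E.
  apply: eq_integral => y _; rewrite /undercut_cost -sumEFin.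
  apply: eq_bigr => j _; rewrite -EFinM; congr (_%:E).
  rewrite (bigD1 k) //= -mulrA [in RHS](mulrC (rest j)); congr (_ * (_ * _)).
    rewrite /undercut ltnn /update eqxx indicE; congr (_%:R).
    by congr nat_of_bool; apply/idP/idP; rewrite inE.
  apply: eq_bigr => l /andP[_ lk].
  by rewrite /undercut /update (negbTE lk).
rewrite ge0_integral_sum //; last 2 first.
- move=> j; apply: emeasurable_funM => //.
  by apply/measurable_EFinP; exact: measurable_indic.
- by move=> j y _; rewrite mule_ge0 // lee_fin ?mulr_ge0.
rewrite /undercut_cost -sumEFin; apply: lee_sum => j _.
rewrite ge0_integralZl_EFin ?mulr_ge0 //; last first.
  by apply/measurable_EFinP; exact: measurable_indic.
rewrite integral_indic // setIT (bigD1 k) //= [in leLHS]mulrCA mulrC EFinM.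
have -> : \prod_(l < n | (l != i) && (l != k)) undercut k.+1 x d j l = rest j.
  apply: eq_bigr => l /andP[_ lk]; rewrite /undercut ltnS leq_eqVlt.
  by rewrite (inj_eq val_inj) (negbTE lk).
apply: lee_wpmul2l; first by rewrite lee_fin mulr_ge0.
by rewrite /undercut leqnn; exact: tailP.
Qed.

(* Tonelli moves the integration over machine [i] outside the integrations
   over the machines with a larger index. *)
Lemma iexp_ge_undercut_cost k f d :
  (forall d', (undercut_cost 0 (d' i) d')%:E <= f d')%E -> (k <= n)%N ->
  if (k <= i)%N then ((undercut_cost k (d i) d)%:E <= iexp P k f d)%E
  else (\int[P i]_x (undercut_cost k x d)%:E <= iexp P k f d)%E.
Proof.
(* While [k <= i], the row of machine [i] is still the fixed [d i]; beyond that it is an integration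
   variable. *)
move=> hf; elim: k d => [|k IH] d kn; first exact: hf.
set K := Ordinal kn.
have f0 d' : (0 <= f d')%E.
  by apply: le_trans (hf d'); rewrite lee_fin undercut_cost_ge0.
rewrite (iexpS P K); case: (ltngtP k i) => [ki|ik|eki].
- have Ki : K != i by rewrite -val_eqE /= neq_ltn ki.
  apply: (le_trans (undercut_cost_step (d i) d Ki)).
  apply: ge0_le_integral_nomeas => y; first by rewrite lee_fin undercut_cost_ge0.
  have e : update d K y i = d i by rewrite /update eq_sym (negbTE Ki).
  by have := IH (update d K y) (ltnW kn); rewrite (ltnW ki) e.
- have Ki : K != i by rewrite -val_eqE /= neq_ltn ik orbT.
  apply: (@le_trans _ _
    (\int[P i]_x \int[P K]_y (undercut_cost k x (update d K y))%:E)%E).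
    apply: ge0_le_integral_nomeas => x.
      by rewrite lee_fin undercut_cost_ge0.
    exact: (undercut_cost_step x d Ki).
  rewrite (fubini_tonelli (fun z => (undercut_cost k z.1 (update d K z.2))%:E));
    last 2 first.
  + by apply/measurable_EFinP; exact: measurable_undercut_cost.
  + by move=> z; rewrite lee_fin undercut_cost_ge0.
  apply: ge0_le_integral_nomeas => y.
    by apply: integral_ge0 => x _; rewrite lee_fin undercut_cost_ge0.
  by have := IH (update d K y) (ltnW kn); rewrite leqNgt ik.
- have Ki : K = i by exact: val_inj.
  rewrite Ki; apply: ge0_le_integral_nomeas => x.
    by rewrite lee_fin undercut_cost_ge0.
  have e : update d i x i = x by rewrite /update eqxx.
  have := IH (update d i x) (ltnW kn).
  rewrite eki leqnn e; apply: le_trans; rewrite lee_fin.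
  (* The product omits machine [i], so integrating that machine out changes no factor. *)
  rewrite le_eqVlt; apply/orP; left; apply/eqP; apply: eq_bigr => j _.
  congr (_ * _); apply: eq_bigr => l li.
  rewrite /undercut /update (negbTE li) ltnS leq_eqVlt.
  by rewrite (inj_eq val_inj) (negbTE li).
Qed.

(** At [k = n] every factor is [p], and a bound valid for each pure declaration [x] is averaged over
    [P i], on which [tailP] imposes nothing. *)
Lemma expect_ge_undercut_cost f (c : R) : 0 <= c ->
  (forall d, (undercut_cost 0 (d i) d)%:E <= f d)%E ->
  (forall x, c <= \sum_(j < m) w j x * \prod_(l < n | l != i) p j x) ->
  (c%:E <= expect P f)%E.
Proof.
move=> c0 hf hc; rewrite /expect.
have := iexp_ge_undercut_cost (fun=> default_row R m) hf (leqnn n).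
rewrite leqNgt ltn_ord /=; apply: le_trans.
rewrite (_ : c%:E = \int[P i]_x (cst c%:E) x)%E; last first.
  by rewrite integral_cst //= [X in (_ * X)%E]probability_setT mule1.
apply: ge0_le_integral_nomeas => x; rewrite lee_fin //.
apply: (le_trans (hc x)); rewrite le_eqVlt; apply/orP; left; apply/eqP.
apply: eq_bigr => j _; congr (_ * _); apply: eq_bigr => l _.
by rewrite /undercut ltn_ord.
Qed.

End Undercut.
End IteratedExpectation.

(** * The equilibrium of Greedy built on an allocation *)

Section Greedy.
Context (R : realType) (n m : nat).
Variables (t : 'I_n -> 'I_m -> R) (tb : 'I_m -> n.-tuple R -> 'I_n).
Hypotheses (t0 : forall i j, 0 <= t i j) (tbP : tie_breaking tb).

Lemma tb_min (d : 'I_n -> Row R m) j k :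
  tnth (d (tb j (column d j))) j <= tnth (d k) j.
Proof. by have [/(_ j (column d j) k)] := tbP; rewrite !tnth_mktuple. Qed.

Lemma exec_time_ge0 d i j : 0 <= exec_time t d i j.
Proof. by rewrite /exec_time le_max t0 orbT. Qed.

Lemma load_ge0 d i : 0 <= load tb t d i.
Proof. by apply: sumr_ge0 => j _; exact: exec_time_ge0. Qed.

Lemma realized_makespan_ge0 d : 0 <= realized_makespan tb t d.
Proof. exact: bigmax_ge_id. Qed.

Section Equilibrium.
Variable A : {ffun 'I_m -> 'I_n}.

(** The [+ 1] rules out ties with the owner and keeps the Pareto minimum positive when the true time
    is zero. *)
Definition outbid_price j := t (A j) j + 1.

Definition equilibrium_support i : set (Row R m) :=
  [set y | forall j,
     (if A j == i then [set t i j] else [set` `[outbid_price j, +oo[%R])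
       (tnth y j)].

Lemma measurable_equilibrium_support i : measurable (equilibrium_support i).
Proof.
apply: (measurable_all_coord (C := fun j => if A j == i then [set t i j]
  else [set` `[outbid_price j, +oo[%R])) => j.
by case: ifP.
Qed.

Section OnSupport.
Variable d : 'I_n -> Row R m.
Hypothesis dS : forall i, equilibrium_support i (d i).

Lemma greedy_alloc_support i j : greedy_alloc tb d i j = (A j == i).
Proof.
rewrite /greedy_alloc; congr (_ == _); apply/eqP; rewrite -[_ == _]negbK.
apply/negP => /negbTE ne; have := tb_min d j (A j).
have := dS (A j) j; rewrite eqxx /= => ->.
have := dS (tb j (column d j)) j; rewrite eq_sym ne /= in_itv /= andbT.
by move=> h1 h2; have := le_trans h1 h2; rewrite /outbid_price gerDl ler10.
Qed.

Lemma load_support i : load tb t d i = \sum_(j < m | A j == i) t i j.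
Proof.
rewrite /load (eq_bigl _ _ (greedy_alloc_support i)).
apply: eq_bigr => j Aji; rewrite /exec_time.
by have := dS i j; rewrite Aji /= => ->; rewrite maxxx.
Qed.

Lemma realized_makespan_support : realized_makespan tb t d = alloc_makespan t A.
Proof. by apply: eq_bigr => i _; exact: load_support. Qed.

End OnSupport.

(** The factors number at most [n] and are at most 1, so the product is at least the [n]-th power,
    [(a + 1) / Num.max x (a + 1)]. This is 1 for [x <= a + 1]; above, multiplying by the price [x]
    gives [a + 1]. *)
Lemma undercut_pareto_cost (x a : R) (i : 'I_n) : 0 <= a ->
  a <= Num.max x a * \prod_(l < n | l != i) pareto_tail n (a + 1) x.
Proof.
move=> a0; have c0 : 0 < a + 1 by rewrite ltr_wpDl.
have n0 : (0 < n)%N := leq_ltn_trans (leq0n i) (ltn_ord i).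
have mx0 : 0 < Num.max x (a + 1) by rewrite lt_max c0 orbT.
apply: (@le_trans _ _ (Num.max x a * pareto_tail n (a + 1) x ^+ n)).
  rewrite pareto_tail_exprn // mulrA ler_pdivlMr //.
  have [xc|cx] := leP x (a + 1).
    by rewrite ler_wpM2r ?(ltW c0) // le_max lexx orbT.
  rewrite (max_idPl _) ?(le_trans _ (ltW cx)) ?lerDl //.
  by rewrite mulrC ler_wpM2l ?lerDl // (le_trans (ltW c0) (ltW cx)).
rewrite ler_wpM2l ?le_max ?a0 ?orbT // prodr_const.
rewrite ler_wiXn2l ?pareto_tail_ge0 ?pareto_tail_le1 //.
by rewrite (leq_trans (max_card _)) // card_ord.
Qed.

Definition undercut_weight i j (x : Row R m) : R :=
  if A j == i then Num.max (tnth x j) (t i j) else 0.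

(** When [i] does not own [j], some other machine bids its true time there without a heavy tail; 0
    is then a safe lower bound. *)
Definition undercut_tail i j (x : Row R m) : R :=
  if A j == i then pareto_tail n (outbid_price j) (tnth x j) else 0.

Lemma undercut_cost_le_load d i :
  undercut_cost i (undercut_weight i) (undercut_tail i) 0 (d i) d <=
  load tb t d i.
Proof.
rewrite /load big_mkcond /undercut_cost; apply: ler_sum => j _.
have w0 : 0 <= undercut_weight i j (d i).
  by rewrite /undercut_weight; case: ifP => // _; rewrite le_max t0 orbT.
case: ifPn => [_|notalloc].
  apply: (@le_trans _ _ (undercut_weight i j (d i))).
    rewrite ler_piMr // prodr_ile1 // => l _.
    by rewrite /undercut ltn0 ler0n lern1 leq_b1.
  by rewrite /undercut_weight; case: ifP => // _; exact: exec_time_ge0.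
(* The winner of [j] is another machine whose bid is not above that of [i], so its factor
   vanishes. *)
rewrite (bigD1 (tb j (column d j))) //= /undercut ltn0 ltNge tb_min.
by rewrite mul0r mulr0.
Qed.

Lemma sum_le_undercut i x :
  \sum_(j < m | A j == i) t i j <=
  \sum_(j < m)
    undercut_weight i j x * \prod_(l < n | l != i) undercut_tail i j x.
Proof.
rewrite big_mkcond; apply: ler_sum => j _.
rewrite /undercut_weight /undercut_tail /outbid_price.
case: ifP => [/eqP ->|_]; last by rewrite mul0r.
exact: undercut_pareto_cost.
Qed.

Lemma optimal_equilibrium : (0 < n)%N ->
  exists P : 'I_n -> probability (Row R m) R,
    mixed_NE tb t P /\ exp_makespan tb t P = (alloc_makespan t A)%:E.
Proof.
move=> n0.
have c0 j : 0 < outbid_price j by rewrite /outbid_price ltr_wpDl.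
have [P PP] := choice (fun i : 'I_n =>
  heavy_tailed_row (fun j => A j == i) (t i) n0 c0).
have PS i : P i (equilibrium_support i) = 1%E.
  have [+ _] := PP i; apply => y hy j; move: (hy j).
  by case: ifP => //= _; rewrite in_itv /= andbT.
exists P; split; last first.
  apply: (expect_as_cst measurable_equilibrium_support PS).
  - exact: bigmax_ge_id.
  - by move=> d; rewrite lee_fin realized_makespan_ge0.
  - by move=> d dS; rewrite realized_makespan_support.
split=> [i|i Q _].
  have [+ _] := PP i; apply => y hy j; move: (hy j).
  by case: ifP => [_ -> //|_]; apply: le_trans; exact: ltW.
have sum0 : 0 <= \sum_(j < m | A j == i) t i j by exact: sumr_ge0.
rewrite /exp_cost (expect_as_cst measurable_equilibrium_support PS sum0);
  last 2 first.
- by move=> d; rewrite lee_fin load_ge0.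
- by move=> d dS; rewrite load_support.
apply: (expect_ge_undercut_cost (i := i) (w := undercut_weight i)
  (p := undercut_tail i)) => //.
- move=> j x; rewrite /undercut_weight.
  by case: ifP => // _; rewrite le_max t0 orbT.
- move=> j x; rewrite /undercut_tail.
  by case: ifP => // _; exact: pareto_tail_ge0.
- move=> j; rewrite /undercut_weight; case: (A j == i) => //.
  by apply: measurable_maxr => //; exact: measurable_tnth.
- move=> j; rewrite /undercut_tail; case: (A j == i) => //.
  exact: (measurableT_comp (measurable_pareto_tail _ _)
    (@measurable_tnth _ R m j)).
- move=> l j x li; rewrite /deviate (negbTE li) /undercut_tail.
  (* If [i] owns [j], then [l] does not, so the undeviated row of [l] has the Pareto tail on [j]. *)
  case: ifP => [/eqP Aj|_]; last by rewrite measure_ge0.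
  by have [_] := PP l; apply; rewrite Aj eq_sym.
- by move=> d; rewrite lee_fin undercut_cost_le_load.
- exact: sum_le_undercut.
Qed.

End Equilibrium.
End Greedy.

(** With a machine available some allocation exists, so the minimum is not merely its default
    [+oo]. *)
Lemma opt_makespan_attained (R : realType) (n m : nat) (t : 'I_n -> 'I_m -> R) :
  (0 < n)%N ->
  exists A : {ffun 'I_m -> 'I_n}, opt_makespan t = (alloc_makespan t A)%:E.
Proof.
move=> n0; rewrite /opt_makespan.
have [|A _ ->] := @eq_bigmin _ (\bar R) _ +oo%E
  [ffun=> Ordinal n0] xpredT (fun A => (alloc_makespan t A)%:E) isT.
  by move=> A _; exact: leey.
by exists A.
Qed.

Theorem theorem8 (R : realType) (n m : nat) (t : 'I_n -> 'I_m -> R)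
  (tb : 'I_m -> n.-tuple R -> 'I_n) :
  (0 < n)%N ->
  (forall i j, 0 <= t i j) ->
  tie_breaking tb ->
  exists P : 'I_n -> probability (Row R m) R,
    mixed_NE tb t P /\ exp_makespan tb t P = opt_makespan t.
Proof.
move=> n0 t0 tbP; have [A ->] := opt_makespan_attained t n0.
exact: optimal_equilibrium.
Qed.
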